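(* Let $(\mu_k)_{k\in\mathbb{N}}$ be a sequence in $\mathcal{N}^{\#}_{\mathcal{X}}$ and $\mu\in\mathcal{N}^{\#}_{\mathcal{X}}$. Then the following statements are equivalent: (i) $d^{\#}(\mu_k,\mu)\to 0$ as $k\to\infty$; (ii) $\int_{\mathcal{X}} f(x)\,\mu_k(dx)\to\int_{\mathcal{X}} f(x)\,\mu(dx)$ as $k\to\infty$ for all bounded continuous functions $f$ on $\mathcal{X}$ vanishing outside a bounded set; (iii) there exists an increasing sequence $(r_n)_{n\in\mathbb{N}}$ with $r_n\to\infty$ as $n\to\infty$ such that $d(\mu_k^{(r_n)},\mu^{(r_n)})\to 0$ as $k\to\infty$ for all $n\in\mathbb{N}$; (iv) $\mu_k(A)\to\mu(A)$ as $k\to\infty$ for all bounded sets $A\in\mathcal{B}(\mathcal{X})$ such that $\mu(\partial A)=0$.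
   Context: $\mathcal{X}$ is a complete separable metric space with Borel $\sigma$-algebra $\mathcal{B}(\mathcal{X})$ and a fixed origin $x_0\in\mathcal{X}$. $B_r(x)$ is the open ball of radius $r\ge 0$ centred at $x$, and $B_r:=B_r(x_0)$. For $A\subset\mathcal{X}$ and $\varepsilon\ge 0$, $A^{\varepsilon}:=\bigcup_{a\in A}B_{\varepsilon}(a)$; $\partial A$ is the (topological) boundary of $A$. A Borel measure $\xi$ on $\mathcal{X}$ is totally finite if $\xi(\mathcal{X})<\infty$, and boundedly finite if $\xi(A)<\infty$ for every bounded Borel set $A$. $\mathcal{M}_{\mathcal{X}}$ is the space of totally finite Borel measures, and $\mathcal{N}^{\#}_{\mathcal{X}}$ is the space of boundedly finite Borel measures on $\mathcal{X}$ taking values in $\mathbb{N}\cup\{\infty\}$ (nonnegative integers, including $0$, or $\infty$). For a Borel measure $\xi$ and $r\ge 0$, $\xi^{(r)}$ is the restriction $\xi^{(r)}(A):=\xi(A\cap B_r)$, $A\in\mathcal{B}(\mathcal{X})$. The Prohorov distance on $\mathcal{M}_{\mathcal{X}}$ is $$d(\mu,\nu):=\inf\{\varepsilon\ge 0:\ \mu(A)\le\nu(A^{\varepsilon})+\varepsilon\ \text{and}\ \nu(A)\le\mu(A^{\varepsilon})+\varepsilon\ \text{for all closed } A\subset\mathcal{X}\}.$$ The $w^{\#}$-distance on $\mathcal{N}^{\#}_{\mathcal{X}}$ is $$d^{\#}(\mu,\nu):=\int_0^{\infty}e^{-r}\frac{d(\mu^{(r)},\nu^{(r)})}{1+d(\mu^{(r)},\nu^{(r)})}\,dr.$$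 *)

(* Defs.v *)
From HB Require Import structures.
From mathcomp Require Import all_boot all_order all_algebra.
From mathcomp Require Import all_classical all_reals all_analysis.

Set Implicit Arguments.
Unset Strict Implicit.
Unset Printing Implicit Defensive.

Import Order.TTheory GRing.Theory Num.Theory.
Import numFieldNormedType.Exports.

Local Open Scope classical_set_scope.
Local Open Scope ring_scope.

(* The [Pointed] part of [CompletePseudoMetric] is needed to form a
   [measurableType]; it only says that the space is nonempty. The origin of
   the space is a separate parameter below. *)
#[short(type="completeMetricType")]
HB.structure Definition CompleteMetric (R : numDomainType) :=
  {T of CompletePseudoMetric R T & Metric R T}.

Definition separable (T : topologicalType) :=
  exists2 D : set T, countable D & dense D.

Definition boundary (T : topologicalType) (A : set T) : set T :=
  closure A `\` interior A.

(* [bounded_set] of the library is about normed spaces. *)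
Definition metric_bounded (R : realType) (X : metricType R) (A : set X) :=
  exists (x : X) (r : R), A `<=` ball x r.

Definition borel (R : realType) (X : completeMetricType R) :=
  g_sigma_algebraType (@open X).

Section point_measures.
Context {R : realType} {X : completeMetricType R}.
Implicit Types (A : set X) (mu nu xi : {measure set (borel X) -> \bar R}).

Lemma measurable_ball (x : X) (r : R) :
  measurable (ball x r : set (borel X)).
Proof.
apply: sub_sigma_algebra; rewrite openE => y; rewrite ballEmdist /= => xyr.
apply/nbhs_ballP; exists (r - mdist x y); rewrite /= ?subr_gt0// => z.
rewrite ballEmdist /= => yz; apply: (le_lt_trans (metric_triangle x y z)).
by rewrite -ltrBrDl.
Qed.

Definition integer_valued xi :=
  forall B : set (borel X), measurable B ->
    xi B = +oo%E \/ exists n : nat, xi B = n%:R%:E.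

Definition boundedly_finite xi :=
  forall B : set (borel X), measurable B -> metric_bounded (B : set X) ->
    (xi B < +oo)%E.

Definition Nsharp : set {measure set (borel X) -> \bar R} :=
  [set xi | boundedly_finite xi /\ integer_valued xi].

Definition restr_ball (x0 : X) xi (r : R) : {measure set (borel X) -> \bar R} :=
  mrestr xi (measurable_ball x0 r).

(* This is the union of open balls even for [e = 0], where it is empty. *)
Definition enlargement A (e : R) : set X := \bigcup_(a in A) ball a e.

(* For totally finite [mu] and [nu] the set below is nonempty (it contains
   every [e] above both total masses), so that [inf] has its usual meaning. *)
Definition prohorov mu nu : R :=
  inf [set e : R | 0 <= e /\ forall A, closed A ->
    (mu A <= nu (enlargement A e) + e%:E)%E /\
    (nu A <= mu (enlargement A e) + e%:E)%E].

Definition dsharp (x0 : X) mu nu : \bar R :=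
  (\int[lebesgue_measure]_(r in `[0%R, +oo[)
    (expR (- r) * (prohorov (restr_ball x0 mu r) (restr_ball x0 nu r) /
      (1 + prohorov (restr_ball x0 mu r) (restr_ball x0 nu r))))%:E)%E.

End point_measures.

(* Main.v *)
Require Import Defs.
From HB Require Import structures.
From mathcomp Require Import all_boot all_order all_algebra.
From mathcomp Require Import all_classical all_reals all_analysis.
From mathcomp Require Import measurable_realfun.

Import Order.TTheory GRing.Theory Num.Theory.
Import numFieldNormedType.Exports.

Set Implicit Arguments.
Unset Strict Implicit.
Unset Printing Implicit Defensive.

Local Open Scope classical_set_scope.
Local Open Scope ring_scope.

(** All four conditions are equivalent to one semicontinuity property, the
predicate [vague_semicontinuous]: for every closed bounded [F], eventually
[mu_ k F <= mu F], and for every open bounded [G], eventually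
[mu G <= mu_ k G]. For general measures such inequalities hold only up to an
arbitrarily small error. Here all values on bounded sets are natural numbers,
so an error smaller than 1 can be dropped ([natural_ereal_le]).

Integrality gives a second simplification. A decreasing sequence of bounded
sets with empty intersection has measures that tend to 0, hence vanish at some
rank ([Nsharp_bigcap0]). Consequently a closed bounded set has an enlargement
of the same measure, an open bounded set has a shrinking of the same measure,
there are spheres of null measure with radii just above any given one, and
finitely many small balls cover a bounded closed set up to a null set. So the
usual diverging or vanishing auxiliary parameters can be fixed once and for
all.

Each condition implies semicontinuity through the criterion
[vague_semicontinuousI], where a closed set [K] and an enlargement [K^e] of the
same measure have to be compared. For continuity sets one uses [K^(e/2)], whose
boundary lies in the null set [K^e \ K]; for integrals, a Urysohn function that
is 1 on [K] and 0 outside [K^e]; for Prohorov distances, the definition with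
some radius [r] large enough, which may depend on [k]. The last remark covers
the integrated distance as well: if the integral is small, the Prohorov
distance is small for some radius in any given interval of length 1.

Conversely, semicontinuity gives:
- the convergence of [mu_ k A] for a continuity set, because [A] lies between
  its interior and its closure ([vague_semicontinuous_eq]);
- the convergence of integrals, by comparing a function with its staircase
  approximation, a combination of indicators of closed superlevel sets; adding
  a constant to [f] and to [- f] makes the upper bound sufficient
  ([vague_semicontinuous_integral_ub]);
- the convergence of the Prohorov distances on a ball whose sphere is null, by
  comparing the two measures on all unions of balls from a finite cover by
  small balls ([prohorov_restr_cvg]), and this is where separability enters;
- the convergence of the integrated distance, by dominated convergence, since
  only countably many spheres have positive measure
  ([Nsharp_radius_countable]). The integrand is measurable because it depends
  on the radius [r] only through the natural number [mu B_r + nu B_r]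
  ([measurable_prohorov_restr]). *)

(** * Balls, enlargements and shrinkings *)

Section metric_sets.
Context {R : realType} {X : completeMetricType R}.
Implicit Types (A F G U : set X) (x y : X) (r e : R).

Lemma open_mball x r : open (ball x r).
Proof.
rewrite openE => y; rewrite ballEmdist /= => xyr.
apply/nbhs_ballP; exists (r - mdist x y); rewrite /= ?subr_gt0// => z.
rewrite ballEmdist /= => yz; apply: (le_lt_trans (metric_triangle x y z)).
by rewrite -ltrBrDl.
Qed.

Definition cball x r : set X := [set y | mdist x y <= r].

Lemma closed_cball x r : closed (cball x r).
Proof.
rewrite -[cball x r]setCK; apply: open_closedC.
rewrite openE => y /= /negP; rewrite -ltNge => rxy.
apply/nbhs_ballP; exists (mdist x y - r); rewrite /= ?subr_gt0// => z.
rewrite ballEmdist /= => yz /= xzr.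
have := metric_triangle x z y; rewrite (metric_sym z) => xy.
have : mdist x y < r + (mdist x y - r) by apply: (le_lt_trans xy); exact: ler_ltD.
by rewrite addrC subrK ltxx.
Qed.

Lemma sub_ball_cball x r : ball x r `<=` cball x r.
Proof. by move=> y; rewrite ballEmdist /= => /ltW. Qed.

Lemma sub_cball_ball x r s : r < s -> cball x r `<=` ball x s.
Proof. by move=> rs y /= xy; rewrite ballEmdist /=; exact: le_lt_trans rs. Qed.

Lemma sub_ball x r s : r <= s -> ball x r `<=` ball x s.
Proof. by move=> rs y; rewrite !ballEmdist /= => xy; exact: lt_le_trans rs. Qed.

Lemma open_borel U : open U -> measurable (U : set (borel X)).
Proof. by move=> oU; exact: sub_sigma_algebra. Qed.

Lemma closed_borel F : closed F -> measurable (F : set (borel X)).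
Proof.
move=> cF; rewrite -[F]setCK; apply: measurableC.
by apply: open_borel; exact: closed_openC.
Qed.

Lemma metric_bounded_sub A B : A `<=` B -> metric_bounded B -> metric_bounded A.
Proof. by move=> AB [x [r Br]]; exists x, r; exact: subset_trans Br. Qed.

Lemma metric_bounded_ball x r : metric_bounded (ball x r).
Proof. by exists x, r; exact: subset_refl. Qed.

Lemma metric_bounded_cball x r : metric_bounded (cball x r).
Proof. by exists x, (r + 1); apply: sub_cball_ball; rewrite ltrDl. Qed.

Lemma metric_bounded_at x A : metric_bounded A ->
  exists2 r, 0 <= r & A `<=` ball x r.
Proof.
move=> [y [r Ar]]; exists (mdist x y + `|r|).
  by rewrite addr_ge0// mdist_ge0.
move=> z /Ar; rewrite !ballEmdist /= => yzr.
apply: (le_lt_trans (metric_triangle x y z)); rewrite ltrD2l.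
exact: lt_le_trans (ler_norm r).
Qed.

Lemma metric_bounded_closure A : metric_bounded A -> metric_bounded (closure A).
Proof.
move=> [y [r Ar]]; apply: (@metric_bounded_sub _ (cball y r)); last first.
  exact: metric_bounded_cball.
rewrite closureE => z; apply; split; first exact: closed_cball.
exact: subset_trans (@sub_ball_cball _ _).
Qed.

Lemma open_enlargement A e : open (enlargement A e).
Proof. by apply: bigcup_open => x _; exact: open_mball. Qed.

Lemma sub_enlargement A e : 0 < e -> A `<=` enlargement A e.
Proof. by move=> e0 x Ax; exists x => //; exact: ballxx. Qed.

Lemma enlargement_le A e e' : e <= e' -> enlargement A e `<=` enlargement A e'.
Proof. by move=> ee' x [a Aa ax]; exists a => //; exact: sub_ball ax. Qed.

Lemma metric_bounded_enlargement A e :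
  metric_bounded A -> metric_bounded (enlargement A e).
Proof.
move=> [x [r Ar]]; exists x, (r + e) => z [a /Ar].
rewrite !ballEmdist /= => xa az.
by apply: (le_lt_trans (metric_triangle x a z)); exact: ltrD.
Qed.

(** The points at distance at least [e] from the complement of [G]: the closed
counterpart of the enlargement, used to approximate open sets from inside. *)
Definition shrinking G e : set X := ~` enlargement (~` G) e.

Lemma closed_shrinking G e : closed (shrinking G e).
Proof. exact/open_closedC/open_enlargement. Qed.

Lemma sub_shrinking G e : 0 < e -> shrinking G e `<=` G.
Proof. by move=> e0; rewrite -[X in _ `<=` X]setCK; exact/subsetC/sub_enlargement. Qed.

Lemma enlargement_shrinking G e : enlargement (shrinking G e) e `<=` G.
Proof.
move=> x [a ash ax]; apply: contrapT => Gx; apply: ash; exists x => //.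
by move: ax; rewrite !ballEmdist /= metric_sym.
Qed.

Lemma bigcap_enlargement F : closed F ->
  \bigcap_n (enlargement F n.+1%:R^-1) `<=` F.
Proof.
move=> cF x Fx; apply: cF => B /nbhs_ballP[e /= e0 eB].
have [n ne] : exists n, n.+1%:R^-1 < e.
  by exists (Num.truncn e^-1); rewrite invf_plt ?posrE ?invr_gt0//; exact: truncnS_gt.
have [a Fa ax] := Fx n I; exists a; split => //; apply: eB.
by move: ax; rewrite !ballEmdist /= metric_sym => ax; exact: lt_trans ne.
Qed.

End metric_sets.

(** * Measures with natural values on bounded sets *)

Section integer_measures.
Context {R : realType} {X : completeMetricType R}.
Implicit Types (A F G U : set X) (mu nu xi : {measure set (borel X) -> \bar R}).

Definition natural_ereal (x : \bar R) := exists n : nat, x = n%:R%:E.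

(** This removes the error terms of the Prohorov distance and of limits: an
inequality between natural numbers that holds up to [e < 1] holds exactly. *)
Lemma natural_ereal_le x y (e : R) : natural_ereal x -> natural_ereal y ->
  e < 1 -> (x <= y + e%:E)%E -> (x <= y)%E.
Proof.
move=> [n ->] [m ->] e1; rewrite -EFinD !lee_fin ler_nat => nme.
rewrite -ltnS -(ltr_nat R) -natr1.
by apply: (le_lt_trans nme); rewrite ltrD2l.
Qed.

Lemma natural_ereal_lt1 x : natural_ereal x -> (x < 1)%E -> x = 0%E.
Proof. by move=> [n ->]; rewrite lte_fin ltrn1; case: n. Qed.

Lemma Nsharp_natural xi A : Nsharp xi -> measurable (A : set (borel X)) ->
  metric_bounded A -> natural_ereal (xi A).
Proof.
move=> [bxi ixi] mA bA; have [xioo|//] := ixi _ mA.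
by have := bxi _ mA bA; rewrite xioo ltxx.
Qed.

Lemma Nsharp_fin xi A : Nsharp xi -> measurable (A : set (borel X)) ->
  metric_bounded A -> xi A \is a fin_num.
Proof. by move=> Nxi mA bA; have [n ->] := Nsharp_natural Nxi mA bA. Qed.

Lemma measure_setD0 xi A B : measurable (A : set (borel X)) ->
  measurable (B : set (borel X)) -> A `<=` B -> xi (B `\` A) = 0%E ->
  xi B = xi A.
Proof.
move=> mA mB AB BA0.
have -> : B = A `|` (B `\` A) by rewrite setDUK.
by rewrite measureU ?setDIK//= ?BA0 ?adde0//; exact: measurableD.
Qed.

Lemma measure_setD_eq0 xi A B : measurable (A : set (borel X)) ->
  measurable (B : set (borel X)) -> A `<=` B -> xi A \is a fin_num ->
  xi B = xi A -> xi (B `\` A) = 0%E.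
Proof.
move=> mA mB AB finA BA.
have -> : xi (B `\` A) = (xi B - xi A)%E.
  have Boo : (xi B < +oo)%E by rewrite BA ltey_eq finA.
  by rewrite measureD// setIidr.
by rewrite BA subee.
Qed.

(** Continuity from above makes [xi (A n)] tend to 0, and a natural number
smaller than 1 is 0. *)
Lemma Nsharp_bigcap0 xi (A : nat -> set X) : Nsharp xi ->
  (forall n, measurable (A n : set (borel X))) -> nonincreasing_seq A ->
  metric_bounded (A 0) -> \bigcap_n A n = set0 -> exists n, xi (A n) = 0%E.
Proof.
move=> Nxi mA dA bA A0.
have xiA n : natural_ereal (xi (A n)).
  apply: Nsharp_natural => //; apply: metric_bounded_sub bA.
  exact/subsetPset/dA.
have : xi (A n) @[n --> \oo] --> xi (\bigcap_n A n).
  by apply: nonincreasing_cvg_mu; rewrite ?A0//; exact: (Nxi.1 _ (mA 0) bA).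
rewrite A0 measure0.
move=> /(_ [set y | y < 1]%E) [].
  by apply: open_nbhs_nbhs; split; [exact: open_ereal_lt_ereal|exact: lte01].
by move=> n _ /(_ n (leqnn n)) /= An1; exists n; exact: natural_ereal_lt1.
Qed.

End integer_measures.

(** * Sets that can be perturbed without changing their measure *)

Section continuity_sets.
Context {R : realType} {X : completeMetricType R}.
Implicit Types (A F G K U : set X) (mu nu xi : {measure set (borel X) -> \bar R}).

(** A closed set is the intersection of its enlargements, so the sets
[enlargement F e `\` F] decrease to the empty set as [e] tends to 0. *)
Lemma Nsharp_enlargement xi F : Nsharp xi -> closed F -> metric_bounded F ->
  exists2 e : R, 0 < e & xi (enlargement F e) = xi F.
Proof.
move=> Nxi cF bF.
have m (e : R) : measurable (enlargement F e : set (borel X)).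
  by apply: open_borel; exact: open_enlargement.
have mF := closed_borel cF.
have [n m1 nm1|||n n0] := Nsharp_bigcap0
  (A := fun n => enlargement F n.+1%:R^-1 `\` F) Nxi (fun n => measurableD (m _) mF).
- apply/subsetPset => x [ex Fx]; split => //.
  by apply: enlargement_le ex; rewrite lef_pV2 ?posrE// ler_nat.
- apply: (metric_bounded_sub (B := enlargement F 1)).
    by rewrite invr1; exact: subDsetl.
  exact: metric_bounded_enlargement.
- apply/seteqP; split => // x Ax; have [_ Fx] := Ax 0 I; apply: Fx.
  by apply: bigcap_enlargement => // k _; have [] := Ax k I.
- exists n.+1%:R^-1; first by rewrite invr_gt0.
  by apply: measure_setD0 => //; apply: sub_enlargement; rewrite invr_gt0.
Qed.

(** An open set is the union of its shrinkings, so the sets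
[G `\` shrinking G e] decrease to the empty set as [e] tends to 0. *)
Lemma Nsharp_shrinking xi G : Nsharp xi -> open G -> metric_bounded G ->
  exists2 e : R, 0 < e & xi (shrinking G e) = xi G.
Proof.
move=> Nxi oG bG.
have m (e : R) : measurable (shrinking G e : set (borel X)).
  by apply: closed_borel; exact: closed_shrinking.
have mG := open_borel oG.
have [n p np|||n n0] := Nsharp_bigcap0
  (A := fun n => G `\` shrinking G n.+1%:R^-1) Nxi (fun n => measurableD mG (m _)).
- apply/subsetPset => x [Gx /contrapT ex]; split => //; apply.
  by apply: enlargement_le ex; rewrite lef_pV2 ?posrE// ler_nat.
- by apply: (metric_bounded_sub (B := G)) => //; exact: subDsetl.
- apply/seteqP; split => // x Ax; have [Gx _] := Ax 0 I.
  suff : (~` G) x by [].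
  apply: bigcap_enlargement; first exact: open_closedC.
  by move=> k _; have [_ /contrapT] := Ax k I.
- exists n.+1%:R^-1; first by rewrite invr_gt0.
  apply/esym; apply: measure_setD0 => //.
  by apply: sub_shrinking; rewrite invr_gt0.
Qed.

(** In a general metric space [ball x (r + e)] need not be close to an
enlargement of [cball x r], so this is not an instance of
[Nsharp_enlargement]. *)
Lemma Nsharp_annulus xi (x : X) (r : R) : Nsharp xi ->
  exists2 e : R, 0 < e & xi (ball x (r + e) `\` cball x r) = 0%E.
Proof.
move=> Nxi.
have m (e : R) : measurable (ball x (r + e) : set (borel X)).
  by apply: open_borel; exact: open_mball.
have mr : measurable (cball x r : set (borel X)).
  by apply: closed_borel; exact: closed_cball.
have [n p np|||n n0] := Nsharp_bigcap0
  (A := fun n => ball x (r + n.+1%:R^-1) `\` cball x r) Nxi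
  (fun n => measurableD (m _) mr).
- apply/subsetPset => y [xy ry]; split => //.
  by apply: sub_ball xy; rewrite lerD2l lef_pV2 ?posrE// ler_nat.
- apply: (metric_bounded_sub (B := ball x (r + 0.+1%:R^-1))).
    exact: subDsetl.
  exact: metric_bounded_ball.
- apply/seteqP; split => // y Ay; have [_ /negP] := Ay 0 I.
  rewrite -ltNge -subr_gt0 => ry.
  have [] := Ay (Num.truncn (mdist x y - r)^-1) I.
  rewrite ballEmdist /= -ltrBlDl => yn _; move: yn; apply/negP; rewrite -leNgt.
  by rewrite ltW// invf_plt ?posrE//; exact: truncnS_gt.
- by exists n.+1%:R^-1; first by rewrite invr_gt0.
Qed.

(** All spheres inside a null annulus are null. The upper bound [r + 1] makes
radii chosen above successive integers increasing. *)
Lemma Nsharp_radius xi (x : X) (r : R) : Nsharp xi ->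
  exists2 s : R, r < s < r + 1 & xi (cball x s) = xi (ball x s).
Proof.
move=> Nxi; have [e e0 xie] := Nsharp_annulus x r Nxi.
pose d := Num.min e 1 / 2.
have d0 : 0 < d by rewrite divr_gt0// lt_min e0 ltr01.
have dm : d < Num.min e 1.
  by rewrite /d ltr_pdivrMr// ltr_pMr ?ltr1n// lt_min e0 ltr01.
have /andP[de d1] : (d < e) && (d < 1) by rewrite -lt_min.
have mb (s : R) : measurable (ball x s : set (borel X)).
  by apply: open_borel; exact: open_mball.
have mc (s : R) : measurable (cball x s : set (borel X)).
  by apply: closed_borel; exact: closed_cball.
exists (r + d); first by rewrite ltrDl d0 ltrD2l.
apply: measure_setD0 => //; first exact: sub_ball_cball.
apply: (subset_measure0 _ _ _ xie); [exact: measurableD|exact: measurableD|].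
move=> y [/= yd]; rewrite !ballEmdist /= => /negP; rewrite -leNgt => dy; split.
  by apply: (le_lt_trans yd); rewrite ltrD2l.
by apply/negP; rewrite -ltNge; apply: lt_le_trans dy; rewrite ltrDl.
Qed.

Lemma closure_enlargement A (e e' : R) : e < e' ->
  closure (enlargement A e) `<=` enlargement A e'.
Proof.
move=> ee' x /(_ (ball x (e' - e))) [].
  by apply/nbhs_ballP; exists (e' - e); rewrite /= ?subr_gt0.
move=> y [[a Aa ay] xy]; exists a => //; move: ay xy; rewrite !ballEmdist /=.
move=> ay xy; apply: (le_lt_trans (metric_triangle a y x)).
by rewrite -(subrKC e e') ltrD// metric_sym.
Qed.

End continuity_sets.

(** * Semicontinuity on closed and open sets *)

Section vague.
Context {R : realType} {X : completeMetricType R}.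
Implicit Types (A F G K U : set X) (mu nu xi : {measure set (borel X) -> \bar R}).

(** The portmanteau inequalities for bounded sets, in the exact form that
integrality allows: they hold eventually, without error term. *)
Definition vague_semicontinuous (mu_ : nat -> {measure set (borel X) -> \bar R})
    mu :=
  (forall F, closed F -> metric_bounded F ->
     \forall k \near \oo, (mu_ k F <= mu F)%E) /\
  (forall G, open G -> metric_bounded G ->
     \forall k \near \oo, (mu G <= mu_ k G)%E).

Variables (mu_ : nat -> {measure set (borel X) -> \bar R})
  (mu : {measure set (borel X) -> \bar R}).
Hypotheses (mu_N : forall k : nat, Nsharp (mu_ k)) (muN : Nsharp mu).

(** It suffices to treat a closed set [K] together with an enlargement of the
same measure: a closed [F] has such an enlargement, and an open [G] has the
measure of a closed [K] whose enlargement [K^e] is still contained in [G]. *)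
Lemma vague_semicontinuousI :
  (forall K (e : R), closed K -> metric_bounded K -> 0 < e ->
    mu (enlargement K e) = mu K ->
    \forall k \near \oo,
      (mu_ k K <= mu K)%E /\ (mu K <= mu_ k (enlargement K e))%E) ->
  vague_semicontinuous mu_ mu.
Proof.
move=> H; split=> [F cF bF|G oG bG].
  have [e e0 Fe] := Nsharp_enlargement muN cF bF.
  by apply: filterS (H F e cF bF e0 Fe) => k [].
have [e e0 Ge] := Nsharp_shrinking muN oG bG.
have mK : measurable (shrinking G e : set (borel X)).
  by apply: closed_borel; exact: closed_shrinking.
have mKe : measurable (enlargement (shrinking G e) e : set (borel X)).
  by apply: open_borel; exact: open_enlargement.
have mG := open_borel oG.
have : \forall k \near \oo, (mu_ k (shrinking G e) <= mu (shrinking G e))%E /\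
    (mu (shrinking G e) <= mu_ k (enlargement (shrinking G e) e))%E.
  apply: H => //; first exact: closed_shrinking.
    by apply: metric_bounded_sub bG; exact: sub_shrinking.
  apply/eqP; rewrite eq_le; apply/andP; split.
    by rewrite Ge le_measure ?inE//; exact: enlargement_shrinking.
  by rewrite le_measure ?inE//; exact: sub_enlargement.
apply: filterS => k [_]; rewrite Ge => /le_trans; apply.
by rewrite le_measure ?inE//; exact: enlargement_shrinking.
Qed.

(** Along the chain [mu_ k G <= mu_ k A <= mu_ k F] the semicontinuity
inequalities force equality, eventually and not only in the limit. *)
Lemma vague_semicontinuous_eq A F G : vague_semicontinuous mu_ mu ->
  measurable (A : set (borel X)) -> closed F -> metric_bounded F -> open G ->
  G `<=` A -> A `<=` F -> mu F = mu G ->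
  \forall k \near \oo, mu_ k A = mu A.
Proof.
move=> [V1 V2] mA cF bF oG GA AF FG.
have mF := closed_borel cF; have mG := open_borel oG.
have bG : metric_bounded G.
  by apply: metric_bounded_sub bF; exact: subset_trans AF.
apply: filterS2 (V1 F cF bF) (V2 G oG bG) => k kF kG.
apply/eqP; rewrite eq_le; apply/andP; split.
  apply: (@le_trans _ _ (mu_ k F)); first by rewrite le_measure ?inE.
  by rewrite (le_trans kF)// FG le_measure ?inE.
apply: (@le_trans _ _ (mu F)); first by rewrite le_measure ?inE.
by rewrite FG (le_trans kG)// le_measure ?inE.
Qed.

Lemma vague_semicontinuous_cvg A : vague_semicontinuous mu_ mu ->
  measurable (A : set (borel X)) -> metric_bounded A ->
  mu (boundary A) = 0%E -> mu_ k A @[k --> \oo] --> mu A.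
Proof.
move=> V mA bA A0.
have mc : measurable (closure A : set (borel X)).
  by apply: closed_borel; exact: closed_closure.
have mi : measurable (A^° : set (borel X)).
  by apply: open_borel; exact: open_interior.
apply: cvg_near_cst.
apply: (@vague_semicontinuous_eq A (closure A) A^°) => //.
- exact: closed_closure.
- exact: metric_bounded_closure.
- exact: open_interior.
- exact: interior_subset.
- exact: subset_closure.
- apply: measure_setD0 => //.
  exact: subset_trans (@interior_subset _ _) (@subset_closure _ _).
Qed.

Lemma cvge_near_le (u : nat -> \bar R) (l : \bar R) (e : R) : 0 < e ->
  l \is a fin_num -> u k @[k --> \oo] --> l ->
  \forall k \near \oo, (u k <= l + e%:E)%E /\ (l <= u k + e%:E)%E.
Proof.
move=> e0 /fineK <- /fine_cvgP[ufin /cvgrPdist_le/(_ _ e0)].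
apply: filterS2 ufin => k /fineK <-; rewrite /= ler_distl => /andP[ul lu].
by rewrite -!EFinD !lee_fin lu -lerBlDr.
Qed.

(** The enlargement [K^(e/2)] is a continuity set between [K] and [K^e]: its
closure is contained in [K^e] and [K] is contained in its interior, so its
boundary is part of the null set [K^e \ K]. *)
Lemma vague_semicontinuous_of_continuity_sets :
  (forall A : set (borel X), measurable A -> metric_bounded (A : set X) ->
      mu (boundary (A : set X)) = 0%E -> mu_ k A @[k --> \oo] --> mu A) ->
  vague_semicontinuous mu_ mu.
Proof.
move=> H; apply: vague_semicontinuousI => K e cK bK e0 Ke.
pose A := enlargement K (e / 2).
have e20 : 0 < e / 2 by rewrite divr_gt0.
have ee : e / 2 < e by rewrite ltr_pdivrMr// ltr_pMr// ltr1n.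
have mE (d : R) : measurable (enlargement K d : set (borel X)).
  by apply: open_borel; exact: open_enlargement.
have mA : measurable (A : set (borel X)) := mE _.
have mK := closed_borel cK.
have bE d := metric_bounded_enlargement d bK.
have bA : metric_bounded A := bE _.
have mub : mu (boundary A) = 0%E.
  have := measure_setD_eq0 mK (mE e) (sub_enlargement e0)
    (Nsharp_fin muN mK bK) Ke.
  apply: subset_measure0.
  - apply: measurableD; first by apply: closed_borel; exact: closed_closure.
    by apply: open_borel; exact: open_interior.
  - exact: measurableD.
  - move=> x [cx ix]; split; first exact: closure_enlargement cx.
    move=> Kx; apply: ix; rewrite /interior; apply: open_nbhs_nbhs.
    by split; [exact: open_enlargement|exact: sub_enlargement].
have := cvge_near_le (e := 2^-1) _ _ (H A (mE _) (bE _) mub).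
move=> /(_ _ (Nsharp_fin muN (mE _) (bE _))).
rewrite invr_gt0 ltr0n => /(_ isT).
apply: filterS => k [kA Ak].
have AK : mu A = mu K.
  apply/eqP; rewrite eq_le; apply/andP; split.
    by rewrite -Ke le_measure ?inE//; exact: enlargement_le (ltW ee).
  by rewrite le_measure ?inE//; exact: sub_enlargement.
have h2 : 2^-1 < 1 :> R by rewrite invf_lt1 ?ltr1n.
split.
  apply: (@le_trans _ _ (mu_ k A)).
    by rewrite le_measure ?inE//; exact: sub_enlargement.
  by rewrite -AK; apply: natural_ereal_le h2 kA; apply: Nsharp_natural.
rewrite -AK; apply: (@le_trans _ _ (mu_ k A)).
  by apply: natural_ereal_le h2 Ak; apply: Nsharp_natural.
by rewrite le_measure ?inE//; exact: enlargement_le (ltW ee).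
Qed.

End vague.

(** * The Prohorov distance of restrictions to balls *)

Section prohorov_distance.
Context {R : realType} {X : completeMetricType R}.
Implicit Types (A F G K U : set X) (mu nu xi : {measure set (borel X) -> \bar R}).
Variable x0 : X.

Lemma measurable_restr (r : R) A : measurable (A : set (borel X)) ->
  metric_bounded (A `&` ball x0 r) /\
  measurable (A `&` ball x0 r : set (borel X)).
Proof.
move=> mA; split.
  by apply: (metric_bounded_sub (B := ball x0 r)) => //; exact: metric_bounded_ball.
by apply: measurableI => //; exact: Defs.measurable_ball.
Qed.

Lemma restr_ballE xi (r : R) A : restr_ball x0 xi r A = xi (A `&` ball x0 r).
Proof. by []. Qed.

Lemma prohorov_le mu nu (e : R) : 0 <= e ->
  (forall A, closed A -> (mu A <= nu (enlargement A e) + e%:E)%E /\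
                         (nu A <= mu (enlargement A e) + e%:E)%E) ->
  prohorov mu nu <= e.
Proof. by move=> e0 H; apply: ge_inf; [exists 0 => ? []|split]. Qed.

Lemma prohorov_ge0 mu nu : 0 <= prohorov mu nu.
Proof.
rewrite /prohorov; set E := [set e | _].
have [E0|/set0P/negP/negPn/eqP ->] := pselect (E !=set0); last by rewrite inf0.
by apply: lb_le_inf => // e [].
Qed.

(** The infimum of the empty set is 0 by convention, so a small Prohorov
distance provides an admissible [e] only when some admissible number exists;
the sum of the two masses is one. *)
Lemma prohorov_restr_lt mu nu (r d : R) : Nsharp mu -> Nsharp nu ->
  prohorov (restr_ball x0 mu r) (restr_ball x0 nu r) < d ->
  exists2 e : R, 0 <= e < d & forall A, closed A ->
    (mu (A `&` ball x0 r) <= nu (enlargement A e `&` ball x0 r) + e%:E)%E /\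
    (nu (A `&` ball x0 r) <= mu (enlargement A e `&` ball x0 r) + e%:E)%E.
Proof.
move=> Nmu Nnu; rewrite /prohorov; set E := [set e | _] => Ed.
have mB : measurable (ball x0 r : set (borel X)) by exact: Defs.measurable_ball.
have bB := metric_bounded_ball x0 r.
have [n mun] := Nsharp_natural Nmu mB bB.
have [m num] := Nsharp_natural Nnu mB bB.
have E0 : E (n%:R + m%:R).
  split=> [|A cA]; first by rewrite addr_ge0.
  have mA := closed_borel cA.
  have mAB : measurable (A `&` ball x0 r : set (borel X)) by exact: measurableI.
  split; rewrite EFinD !restr_ballE.
    apply: (@le_trans _ _ (mu (ball x0 r))).
      by rewrite le_measure ?inE//; exact: subIsetr.
    by rewrite mun addeCA leeDl// adde_ge0// lee_fin.
  apply: (@le_trans _ _ (nu (ball x0 r))).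
    by rewrite le_measure ?inE//; exact: subIsetr.
  by rewrite num addeA leeDr// adde_ge0// lee_fin.
have hE : has_inf E by split; [exists (n%:R + m%:R)|exists 0 => ? []].
have dE : 0 < d - inf E by rewrite subr_gt0.
have [e [e0 He]] := inf_adherent dE hE.
by rewrite subrKC => ed; exists e => //; rewrite e0.
Qed.

Section vague_prohorov.
Variables (mu_ : nat -> {measure set (borel X) -> \bar R})
  (mu : {measure set (borel X) -> \bar R}).
Hypotheses (mu_N : forall k : nat, Nsharp (mu_ k)) (muN : Nsharp mu).

(** The radius may depend on [k]: only [K^e `<=` ball x0 r] matters, so that
the restrictions do not change the measures of the sets that are compared.
Both the integrated distance and convergence along a fixed sequence of radii
provide this hypothesis. *)
Lemma vague_semicontinuous_of_prohorov :
  (forall r0 d : R, 0 < d -> \forall k \near \oo, exists2 r, r0 <= r &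
    prohorov (restr_ball x0 (mu_ k) r) (restr_ball x0 mu r) < d) ->
  vague_semicontinuous mu_ mu.
Proof.
move=> H; apply: vague_semicontinuousI => // K e cK bK e0 Ke.
have [r0 _ Kr0] := metric_bounded_at x0 (metric_bounded_enlargement e bK).
have d0 : 0 < Num.min e 1 by rewrite lt_min e0 ltr01.
apply: filterS (H r0 _ d0) => k [r r0r /prohorov_restr_lt].
move=> /(_ (mu_N k) muN)[e' /andP[e'0]]; rewrite lt_min => /andP[e'e e'1].
move=> /(_ K cK)[kK Kk].
have Kr : enlargement K e `<=` ball x0 r.
  exact: subset_trans (sub_ball r0r).
have KKe : K `<=` enlargement K e by exact: sub_enlargement.
have KE : K `&` ball x0 r = K by apply/setIidl; exact: subset_trans Kr.
have mK := closed_borel cK.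
have mE : measurable (enlargement K e : set (borel X)).
  by apply: open_borel; exact: open_enlargement.
have mE' : measurable (enlargement K e' : set (borel X)).
  by apply: open_borel; exact: open_enlargement.
have [_ mEr] := measurable_restr r mE'.
have bE := metric_bounded_enlargement e bK.
have EE : enlargement K e' `&` ball x0 r `<=` enlargement K e.
  by move=> x [Kx _]; apply: enlargement_le Kx; exact: ltW.
rewrite KE in kK Kk; split.
  rewrite -Ke; apply: natural_ereal_le e'1 _; [exact: Nsharp_natural..|].
  by apply: (le_trans kK); rewrite leeD2r// le_measure ?inE.
apply: natural_ereal_le e'1 _; [exact: Nsharp_natural..|].
by apply: (le_trans Kk); rewrite leeD2r// le_measure ?inE.
Qed.

(** The balls centred at a dense set cover [F]. The function [f] numbers the
centres, so the part of [F] missed by the balls of number less than [N]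
decreases to the empty set, and it is null for some [N]. *)
Lemma Nsharp_finite_cover xi F (e : R) (f : X -> nat) (D : set X) : Nsharp xi ->
  dense D -> 0 < e -> closed F -> metric_bounded F ->
  exists N, xi (F `\` enlargement [set x | D x /\ (f x < N)%N] e) = 0%E.
Proof.
move=> Nxi dD e0 cF bF; apply: Nsharp_bigcap0 => //.
- move=> n; apply: measurableD; first exact: closed_borel.
  by apply: open_borel; exact: open_enlargement.
- move=> n m nm; apply/subsetPset => x [Fx xm]; split => // -[a [Da an] ax].
  by apply: xm; exists a => //; split => //; exact: leq_trans nm.
- by apply: (metric_bounded_sub (B := F)) => //; exact: subDsetl.
- apply/seteqP; split => // x Fx.
  have [a [xa Da]] : ball x e `&` D !=set0.
    by apply: dD; [exists x; exact: ballxx|exact: open_mball].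
  have [_] := Fx (f a).+1 I; apply; exists a; first by split.
  by move: xa; rewrite !ballEmdist /= metric_sym.
Qed.

(** Fix a finite cover of [cball x0 r], up to a null set, by balls of radius
[e]. A closed set [A] is compared with the union [U J] of the balls of the
cover that meet [A]: [U J] contains [A `&` ball x0 r] up to a set that is null
for [mu] and eventually for [mu_ k], and its closure is contained in
[enlargement A (4 * e)]. There are only finitely many
sets [J], so the inequalities for all the sets [U J] hold from a common rank,
which does not depend on [A]. *)
Lemma prohorov_restr_cvg (r : R) : separable X -> vague_semicontinuous mu_ mu ->
  mu (cball x0 r) = mu (ball x0 r) ->
  prohorov (restr_ball x0 (mu_ k) r) (restr_ball x0 mu r)
    @[k --> \oo] --> (0 : R).
Proof.
move=> [D /countable_injP[f finj] dD] [V1 V2] mur.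
have mB : measurable (ball x0 r : set (borel X)) by exact: Defs.measurable_ball.
have cC : closed (cball x0 r) by exact: closed_cball.
have mC : measurable (cball x0 r : set (borel X)) by exact: closed_borel.
have bC := metric_bounded_cball x0 r.
have BC := @sub_ball_cball _ _ x0 r.
have CB0 : mu (cball x0 r `\` ball x0 r) = 0%E.
  apply: measure_setD_eq0 => //; apply: Nsharp_fin => //.
  exact: metric_bounded_ball.
suff H (e : R) : 0 < e -> \forall k \near \oo,
    prohorov (restr_ball x0 (mu_ k) r) (restr_ball x0 mu r) <= 4 * e.
  apply/cvgrPdist_le => e e0; have e40 : 0 < e / 4 by rewrite divr_gt0.
  apply: filterS (H _ e40) => k.
  by rewrite mulrCA divff ?pnatr_eq0// mulr1 sub0r normrN ger0_norm// prohorov_ge0.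
move=> e0.
have [N muN0] := Nsharp_finite_cover f muN dD e0 cC bC.
pose S (J : {set 'I_N}) := [set x | D x /\ exists2 i : 'I_N, i \in J & f x = i].
pose U J := enlargement (S J) e.
have oU J : open (U J) by exact: open_enlargement.
have mU J : measurable (U J : set (borel X)) by exact: open_borel.
have UT : enlargement [set x | D x /\ (f x < N)%N] e = U [set: 'I_N]%SET.
  rewrite /U; congr enlargement; apply/seteqP; split=> x [Dx].
    by move=> fxN; split => //; exists (Ordinal fxN) => //; rewrite finset.inE.
  by move=> [i _ fxi]; split => //=; rewrite fxi.
rewrite UT in muN0.
have cCU : closed (cball x0 r `\` U [set: 'I_N]%SET).
  by apply: closedI => //; exact: open_closedC.
have mCU : measurable (cball x0 r `\` U [set: 'I_N]%SET : set (borel X)).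
  exact: closed_borel.
have ccU J : closed (closure (U J) `&` cball x0 r).
  by apply: closedI => //; exact: closed_closure.
have nU : \forall k \near \oo, forall J,
    (mu (U J `&` ball x0 r) <= mu_ k (U J `&` ball x0 r))%E.
  apply: filter_forall => J; apply: V2.
    by apply: openI => //; exact: open_mball.
  by have [] := measurable_restr r (mU J).
have nF : \forall k \near \oo, forall J,
    (mu_ k (closure (U J) `&` cball x0 r) <= mu (closure (U J) `&` cball x0 r))%E.
  apply: filter_forall => J; apply: V1 => //.
  by apply: metric_bounded_sub bC; exact: subIsetr.
have nC : \forall k \near \oo, (mu_ k (cball x0 r `\` U [set: 'I_N]%SET) <= 0)%E.
  rewrite -muN0; apply: V1 => //.
  by apply: (metric_bounded_sub (B := cball x0 r)) => //; exact: subDsetl.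
near=> k; apply: prohorov_le => [|A cA]; first by rewrite mulr_ge0// ltW.
have e40 : 0 < 4 * e by rewrite mulr_gt0.
have mA := closed_borel cA.
have mE : measurable (enlargement A (4 * e) : set (borel X)).
  by apply: open_borel; exact: open_enlargement.
have [_ mAB] := measurable_restr r mA.
have [_ mEB] := measurable_restr r mE.
(* The indices of the balls of the cover that meet [A]. *)
pose J := [set i : 'I_N |
  `[< exists x, [/\ D x, f x = i & A `&` ball x e !=set0] >]]%SET.
have [_ mUB] := measurable_restr r (mU J).
have mF := closed_borel (ccU J).
have AU : A `&` ball x0 r `<=` U J `|` (cball x0 r `\` U [set: 'I_N]%SET).
  move=> y [Ay yr]; have [[x [Dx [i _ fxi]] xy]|Uy] := pselect (U [set: 'I_N]%SET y).
    left; exists x => //; split => //; exists i => //.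
    by rewrite finset.inE; apply/asboolP; exists x; split => //; exists y.
  by right; split => //; exact: BC.
have SJA x : S J x -> exists2 a, A a & mdist a x < e.
  move=> [Dx [i]]; rewrite finset.inE => /asboolP[x' [Dx' fx'i [a [Aa]]]].
  rewrite ballEmdist /= => xa fxi; exists a => //.
  by rewrite metric_sym (finj x x') ?inE// fxi.
have UA : U J `<=` enlargement A (2 * e).
  move=> y [x /SJA[a Aa ax] xy]; exists a => //; move: xy.
  rewrite !ballEmdist /= => xy; apply: (le_lt_trans (metric_triangle a x y)).
  by rewrite mulr2n mulrDl !mul1r ltrD.
have e24 : 2 * e < 4 * e by rewrite ltr_pM2r// ltr_nat.
have cUA : closure (U J) `<=` enlargement A (4 * e).
  by apply: subset_trans (closure_enlargement e24); exact: closure_subset.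
have UcU : U J `<=` closure (U J) by exact: subset_closure.
split; rewrite !restr_ballE.
  apply: (@le_trans _ _ (mu (enlargement A (4 * e) `&` ball x0 r))); last first.
    by rewrite leeDl// lee_fin ltW.
  apply: (@le_trans _ _ (mu_ k (closure (U J) `&` cball x0 r))).
    rewrite -[leRHS]adde0.
    apply: (@le_trans _ _ (mu_ k (closure (U J) `&` cball x0 r) +
        mu_ k (cball x0 r `\` U [set: 'I_N]%SET)))%E; last first.
      by rewrite leeD2l//; near: k.
    apply: le_trans (measureU2 (mu_ k) mF mCU).
    rewrite le_measure ?inE//; first exact: measurableU.
    move=> y yA; have [Uy|] := AU y yA; last by right.
    by left; split; [exact: UcU|exact/BC/yA.2].
  (* The passage from [cball x0 r] back to [ball x0 r] costs nothing because
     the sphere is null. *)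
  apply: (@le_trans _ _ (mu (closure (U J) `&` cball x0 r))).
    by have := near nF k; apply.
  rewrite -[leRHS]adde0 -CB0; apply: le_trans (measureU2 mu mEB _); last first.
    exact: measurableD.
  rewrite le_measure ?inE//.
    by apply: measurableU => //; exact: measurableD.
  move=> y [Uy Cy]; have [By|By] := pselect (ball x0 r y).
    by left; split => //; exact: cUA.
  by right.
apply: (@le_trans _ _ (mu_ k (enlargement A (4 * e) `&` ball x0 r))); last first.
  by rewrite leeDl// lee_fin ltW.
apply: (@le_trans _ _ (mu (U J `&` ball x0 r))).
  rewrite -[leRHS]adde0 -muN0; apply: le_trans (measureU2 mu mUB mCU).
  rewrite le_measure ?inE//; first exact: measurableU.
  by move=> y yA; have [Uy|] := AU y yA; [left; split => //; exact: yA.2|right].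
apply: (@le_trans _ _ (mu_ k (U J `&` ball x0 r))).
  by have := near nU k; apply.
rewrite le_measure ?inE// => y [Uy By]; split => //.
exact/cUA/UcU.
Unshelve. all: by end_near. Qed.

End vague_prohorov.
End prohorov_distance.

(** * Integrals of continuous functions *)

Section test_functions.
Context {R : realType} {X : completeMetricType R}.
Implicit Types (A F G K U C : set X) (mu nu xi : {measure set (borel X) -> \bar R}).

Lemma continuous_borel (f : X -> R) : continuous f ->
  measurable_fun [set: borel X] (f : borel X -> R).
Proof.
move=> /continuousP cf; apply: (measurability _ (RGenOpens.measurableE R)).
move=> _ [_ [a [b ->] <-]]; rewrite setTI; apply: open_borel.
exact/cf/interval_open.
Qed.

Lemma continuous_borel_in (C : set (borel X)) (f : X -> R) : continuous f ->
  measurable_fun C (f : borel X -> R).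
Proof. by move=> cf; apply: measurable_funTS; exact: continuous_borel. Qed.

(** The sum is the largest multiple of [h] that is at most [t]: the terms with
[j.+1%:R * h <= t] contribute [h] each, and there are enough of them because
[t < N%:R * h]. *)
Lemma staircase_bounds (h t : R) (N : nat) : 0 < h -> 0 <= t -> t < N%:R * h ->
  \sum_(j < N) h * (j.+1%:R * h <= t)%R%:R <= t
    <= \sum_(j < N) h * (j.+1%:R * h <= t)%R%:R + h.
Proof.
move=> h0 t0; set S := fun N => \sum_(j < N) h * (j.+1%:R * h <= t)%R%:R.
suff H n : (n%:R * h <= t /\ S n = n%:R * h) \/
    (t < n%:R * h /\ S n <= t <= S n + h).
  by case: (H N) => -[]; rewrite -/(S N) ?leNgt; [move=> /negP|].
(* Up to the level of [t] all steps are climbed; above it the sum is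
   constant. *)
elim: n => [|n IH]; first by left; rewrite mul0r /S big_ord0.
have -> : S n.+1 = S n + h * (n.+1%:R * h <= t)%R%:R by rewrite /S big_ord_recr.
have nS : n.+1%:R * h = n%:R * h + h by rewrite -natr1 mulrDl mul1r.
have [nt|tn] := leP (n.+1%:R * h) t.
  left; split => //; rewrite mulr1 nS; case: IH => [[_ ->]//|[tnh]].
  by move: nt; rewrite nS leNgt (lt_trans tnh)// ltrDl.
right; split => //; rewrite mulr0 addr0; case: IH => [[nht ->]|[]//].
by rewrite nht/= -nS ltW.
Qed.

Lemma integral_staircase nu C (A : nat -> set X) (h : R) (N : nat) :
  0 <= h -> measurable (C : set (borel X)) ->
  (forall j, measurable (A j : set (borel X))) ->
  (\int[nu]_(x in C) (\sum_(j < N) h * \1_(A j) x)%:E =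
   \sum_(j < N) h%:E * nu (A j `&` C))%E.
Proof.
move=> h0 mC mA; under eq_integral do rewrite -sumEFin.
have m1 j : measurable_fun (C : set (borel X))
    (fun x : borel X => (\1_(A j) x : R)%:E).
  by apply/measurable_EFinP; exact: measurable_indic.
rewrite ge0_integral_sum//; last 2 first.
- move=> j; under eq_fun do rewrite EFinM.
  exact: measurable_funeM.
- by move=> j x _; rewrite lee_fin mulr_ge0.
apply: eq_bigr => j _; under eq_integral do rewrite EFinM.
by rewrite ge0_integralZl ?lee_fin ?integral_indic// => x _; rewrite lee_fin.
Qed.

Lemma Urysohn_indic K U : closed K -> open U -> K `<=` U ->
  exists2 f : X -> R, continuous f & forall x, \1_K x <= f x <= \1_U x.
Proof.
move=> cK oU KU; pose f := @Urysohn X R (~` U) K.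
have sep : uniform_separator (~` U) K.
  apply: (normal_uniform_separator (@pseudometric_normal R X)) => //.
    exact: open_closedC.
  by rewrite setIC; apply/disjoints_subset; rewrite setCK.
exists f => [|x]; first exact: Urysohn_continuous.
have : f x \in `[0, 1] by apply: (@Urysohn_range X R (~` U) K); exists x.
rewrite in_itv /= => /andP[f0 f1].
rewrite !indicE; apply/andP; split.
  have [/set_mem Kx|] := boolP (x \in K); last by [].
  by rewrite [leRHS](_ : f x = 1)//; apply: (Urysohn_sub1 sep); exists x.
have [//|/negP Ux] := boolP (x \in U).
rewrite (_ : f x = 0)//; apply: (Urysohn_sub0 sep); exists x => //.
by move=> Ux'; apply: Ux; rewrite inE.
Qed.

Section vague_integrals.
Variables (mu_ : nat -> {measure set (borel X) -> \bar R})
  (mu : {measure set (borel X) -> \bar R}).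
Hypotheses (mu_N : forall k : nat, Nsharp (mu_ k)) (muN : Nsharp mu).

(** A Urysohn function [f] for [K] inside [K^e] satisfies
[nu K <= \int f dnu <= nu (K^e)] for every [nu], with equalities for [mu]. *)
Lemma vague_semicontinuous_of_integrals :
  (forall f : X -> R, continuous f -> bounded_fun f ->
      (exists2 B : set X, metric_bounded B & forall x : X, ~ B x -> f x = 0) ->
      (\int[mu_ k]_x (f x)%:E)%E @[k --> \oo] --> (\int[mu]_x (f x)%:E)%E) ->
  vague_semicontinuous mu_ mu.
Proof.
move=> H; apply: vague_semicontinuousI => // K e cK bK e0 Ke.
have oE : open (enlargement K e) by exact: open_enlargement.
have KE : K `<=` enlargement K e by exact: sub_enlargement.
have bE := metric_bounded_enlargement e bK.
have mK := closed_borel cK; have mE := open_borel oE.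
have [f cf fKE] := Urysohn_indic cK oE KE.
have f0 x : 0 <= f x by have /andP[+ _] := fKE x; exact: le_trans.
have int nu : (nu K <= \int[nu]_x (f x)%:E <= nu (enlargement K e))%E.
  have mi A : measurable (A : set (borel X)) ->
      measurable_fun [set: borel X] (fun x : borel X => (\1_A x : R)%:E).
    by move=> mA; apply/measurable_EFinP; exact: measurable_indic.
  have mf : measurable_fun [set: borel X] (fun x : borel X => (f x)%:E).
    by apply/measurable_EFinP; exact: continuous_borel.
  have iE A : measurable (A : set (borel X)) ->
      (\int[nu]_x (\1_A x)%:E = nu A)%E.
    by move=> mA; rewrite integral_indic// setIT.
  rewrite -(iE _ mK) -(iE _ mE).
  apply/andP; split; apply: ge0_le_integral => //; try exact: mi;
    by move=> x _; rewrite lee_fin//; have /andP[] := fKE x.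
have fmu : (\int[mu]_x (f x)%:E = mu K)%E.
  apply/eqP; rewrite eq_le; have /andP[-> fE] := int mu.
  by rewrite -Ke fE.
have h2 : 2^-1 < 1 :> R by rewrite invf_lt1 ?ltr1n.
have := @cvge_near_le R _ (mu K) 2^-1 _ (Nsharp_fin muN mK bK).
rewrite invr_gt0 ltr0n -{1}fmu => /(_ _ isT) cvgK.
apply: filterS (cvgK _ (H f cf _ _)).
- move=> k [fK Kf]; have /andP[Kk Ek] := int (mu_ k); split.
    apply: (natural_ereal_le _ _ h2 (le_trans Kk fK)); exact: Nsharp_natural.
  apply: (natural_ereal_le _ _ h2 (le_trans Kf _)); [exact: Nsharp_natural..|].
  exact: leeD2r.
- exists 1; split => // M M1 x _ /=; rewrite ger0_norm//.
  have /andP[_ /le_trans] := fKE x; apply.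
  by rewrite (le_trans _ (ltW M1))// indicE; case: (_ \in _).
- exists (enlargement K e) => // x Ex; apply/eqP; rewrite eq_le f0 andbT.
  by have /andP[_] := fKE x; rewrite indicE memNset.
Qed.

Hypothesis V : vague_semicontinuous mu_ mu.

(** The superlevel sets of [g] in [C] are closed and bounded, so the integral of
a staircase function below [g] is eventually at most its integral for [mu]. The
staircase is within [h] of [g], hence the error term [h%:E * mu C]. *)
Lemma vague_semicontinuous_integral_ub C (g : X -> R) (M h : R) :
  closed C -> metric_bounded C -> continuous g ->
  (forall x, 0 <= g x <= M) -> 0 < h ->
  \forall k \near \oo,
    (\int[mu_ k]_(x in C) (g x)%:E
       <= \int[mu]_(x in C) (g x)%:E + h%:E * mu C)%E.
Proof.
move=> cC bC cg g0M h0; have mC := closed_borel cC.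
pose N := (Num.truncn (M / h)).+1.
have MN : M < N%:R * h by rewrite -ltr_pdivrMr//; exact: truncnS_gt.
pose A j := [set x | j.+1%:R * h <= g x].
have cA j : closed (A j).
  have /continuous_closedP gP := cg.
  exact: (gP _ (@closed_ge R (j.+1%:R * h))).
have mA j : measurable (A j : set (borel X)) by exact: closed_borel.
have gA x : \sum_(j < N) h * \1_(A j) x <= g x
    <= \sum_(j < N) h * \1_(A j) x + h.
  have /andP[gx0 gxM] := g0M x.
  have := staircase_bounds h0 gx0 (le_lt_trans gxM MN).
  suff -> : \sum_(j < N) h * (j.+1%:R * h <= g x)%R%:R =
      \sum_(j < N) h * \1_(A j) x by [].
  apply: eq_bigr => j _; rewrite indicE; congr (_ * _%:R).
  by apply/esym; congr nat_of_bool; apply/idP/idP; rewrite inE.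
have mS : measurable_fun (C : set (borel X))
    (fun x : borel X => (\sum_(j < N) h * \1_(A j) x)%:E).
  apply/measurable_EFinP; apply: measurable_sum => j.
  by apply: measurable_funM => //; exact: measurable_indic.
have S0 x : 0 <= \sum_(j < N) h * \1_(A j) x.
  by apply: sumr_ge0 => j _; rewrite mulr_ge0// ltW.
have mg : measurable_fun (C : set (borel X)) (fun x : borel X => (g x)%:E).
  by apply/measurable_EFinP; exact: continuous_borel_in.
have g0 x : 0 <= g x by have /andP[] := g0M x.
have nA : \forall k \near \oo, forall j : 'I_N,
    (mu_ k (A j `&` C) <= mu (A j `&` C))%E.
  apply: filter_forall => j; apply: V.1; first exact: closedI.
  by apply: (metric_bounded_sub (B := C)) => //; exact: subIsetr.
apply: filterS2 nA (V.1 C cC bC) => k kA kC.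
have h0' : 0 <= h by exact: ltW.
apply: (@le_trans _ _ (\int[mu_ k]_(x in C)
    ((\sum_(j < N) h * \1_(A j) x)%:E + h%:E))%E).
  apply: ge0_le_integral => //.
  - by move=> x _; rewrite lee_fin.
  - exact: emeasurable_funD.
  - by move=> x _; rewrite -EFinD lee_fin; have /andP[] := gA x.
rewrite ge0_integralD//; last by move=> x _; rewrite lee_fin.
rewrite integral_cst// integral_staircase//; apply: leeD.
  apply: (@le_trans _ _ (\sum_(j < N) h%:E * mu (A j `&` C))%E).
    by apply: lee_sum => j _; rewrite lee_pmul2l ?lte_fin.
  rewrite -integral_staircase//; apply: ge0_le_integral => //.
  - by move=> x _; rewrite lee_fin.
  - by move=> x _; rewrite lee_fin; have /andP[] := gA x.
by rewrite lee_pmul2l ?lte_fin.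
Qed.

(** On a ball with null sphere that contains the support of [f], the total
masses [mu_ k C] are eventually equal to [mu C]. Hence the upper bound for the
nonnegative functions [M + f] and [M - f] gives upper bounds for the integrals
of [f] and [- f], that is, both halves of the convergence. *)
Lemma vague_semicontinuous_integral_cvg (x0 : X) (f : X -> R) :
  continuous f -> bounded_fun f ->
  (exists2 B : set X, metric_bounded B & forall x : X, ~ B x -> f x = 0) ->
  (\int[mu_ k]_x (f x)%:E)%E @[k --> \oo] --> (\int[mu]_x (f x)%:E)%E.
Proof.
move=> cf /ex_strict_bound_gt0[M M0 fM] [B bB fB].
have {}fM x : `|f x| <= M by apply: ltW; exact: fM.
have [r0 _ Br0] := metric_bounded_at x0 bB.
have [r /andP[r0r _] mur] := Nsharp_radius x0 r0 muN.
pose C := cball x0 r.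
have cC : closed C by exact: closed_cball.
have mC : measurable (C : set (borel X)) by exact: closed_borel.
have bC : metric_bounded C by exact: metric_bounded_cball.
have muC : \forall k \near \oo, mu_ k C = mu C.
  apply: (@vague_semicontinuous_eq _ _ _ _ C C (ball x0 r)) => //.
  - exact: open_mball.
  - exact: sub_ball_cball.
have fC nu : (\int[nu]_x (f x)%:E = \int[nu]_(x in C) (f x)%:E)%E.
  rewrite [RHS]integral_mkcond; apply: eq_integral => x _.
  rewrite patchE; case: ifPn => // /negP; rewrite inE => Cx.
  rewrite fB// => /Br0 Bx; apply: Cx; apply: sub_ball_cball.
  by apply: sub_ball Bx; exact: ltW.
have intb xi g : Nsharp xi -> continuous g -> (forall x, `|g x| <= M) ->
    xi.-integrable (C : set (borel X)) (EFin \o g).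
  move=> Nxi cg gM; apply: measurable_bounded_integrable => //.
  - by rewrite ltey_eq Nsharp_fin.
  - exact: continuous_borel_in.
  - by exists M; split; [exact: num_real|] => L ML x _ /=; exact: le_trans (gM x) (ltW ML).
have intM xi : Nsharp xi -> xi.-integrable (C : set (borel X)) (EFin \o cst M).
  by move=> Nxi; apply: intb => // [x|x]; [exact: cvg_cst|rewrite ger0_norm// ltW].
have half g e : continuous g -> (forall x, `|g x| <= M) -> 0 < e ->
    \forall k \near \oo, \int[mu_ k]_(x in C) g x <= \int[mu]_(x in C) g x + e.
  move=> cg gM e0.
  have cMg : continuous (fun x => M + g x).
    by move=> x; apply: cvgD; [exact: cvg_cst|exact: cg].
  have Mg x : 0 <= M + g x <= M + M.
    have := gM x; rewrite ler_norml => /andP[gl gu].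
    by rewrite lerD2l gu -lerBlDl sub0r gl.
  (* Adding 1 to the mass avoids a division by zero. *)
  have h0 : 0 < e / (fine (mu C) + 1).
    by rewrite divr_gt0// ltr_wpDl// fine_ge0.
  have hC : e / (fine (mu C) + 1) * fine (mu C) <= e.
    rewrite mulrAC ler_pdivrMr; last by rewrite ltr_wpDl// fine_ge0.
    by rewrite ler_pM2l// lerDl.
  apply: filterS2 muC
    (vague_semicontinuous_integral_ub cC bC cMg Mg h0) => k kC kM.
  have split xi : Nsharp xi -> (\int[xi]_(x in C) (M + g x)%:E =
      (M * fine (xi C) + \int[xi]_(x in C) g x)%:E)%E.
    move=> Nxi; rewrite -(Rintegral_cst xi mC M) -RintegralD//; first last.
    - exact: intb.
    - exact: intM.
    rewrite /Rintegral fineK//; apply: integrable_fin_num => //.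
    exact: (integrableD mC (intM _ Nxi) (intb _ _ Nxi cg gM)).
  move: kM; rewrite !split// kC -[mu C]fineK ?Nsharp_fin//.
  rewrite -EFinM -EFinD lee_fin -addrA lerD2l => /le_trans; apply.
  by rewrite lerD2l.
have cNf : continuous (- f) by move=> x; apply: cvgN; exact: cf.
have Nf xi : Nsharp xi -> \int[xi]_(x in C) (- f) x = - \int[xi]_(x in C) f x.
  move=> Nxi; rewrite -[RHS]mulN1r -RintegralZl//; last exact: intb.
  by apply: eq_Rintegral => x _; rewrite mulN1r.
have fin xi : Nsharp xi -> (\int[xi]_x (f x)%:E = (\int[xi]_(x in C) f x)%:E)%E.
  move=> Nxi; rewrite fC /Rintegral fineK//; apply: integrable_fin_num => //.
  exact: intb.
rewrite (fin mu)//; under eq_fun do rewrite fin//.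
apply: cvg_EFin; first exact: nearW.
apply/cvgrPdist_le => e e0.
have NfM x : `|(- f) x| <= M by rewrite normrN.
apply: filterS2 (half f e cf fM e0) (half (- f) e cNf NfM e0) => k kf.
rewrite !Nf// => kNf; rewrite ler_distl lerBlDr kf/=.
by rewrite -lerN2 opprD lerBlDr.
Qed.

End vague_integrals.
End test_functions.

(** * The integrated distance *)

Section integrated_distance.
Context {R : realType} {X : completeMetricType R}.
Implicit Types (A F G K U C : set X) (mu nu xi : {measure set (borel X) -> \bar R}).

(** If [u] depends only on a monotone natural number, then a preimage under [u]
is a countable union of fibres of [N], whatever the dependence is. *)
Lemma measurable_fun_of_counter (N u : R -> R) :
  {homo N : r s / r <= s} -> (forall r, exists n : nat, N r = n%:R) ->
  (forall r s, N r = N s -> u r = u s) -> measurable_fun [set: R] u.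
Proof.
move=> ndN natN uN _ Y mY; rewrite setTI.
pose I n := [set r | N r = n%:R /\ exists2 s, N s = n%:R & Y (u s)].
have -> : u @^-1` Y = \bigcup_n I n.
  apply/seteqP; split=> [r Yr|r [n _ [Nr [s Ns Ys]]]].
    by have [n Nr] := natN r; exists n => //; split => //; exists r.
  by rewrite /preimage /= (uN r s)// Nr Ns.
apply: bigcup_measurable => n _.
have mN : measurable (N @^-1` [set n%:R]).
  rewrite -[X in measurable X]setTI.
  exact: (@nondecreasing_measurable R setT N measurableT ndN).
have [Hn|Hn] := pselect (exists2 s, N s = n%:R & Y (u s)).
  by rewrite (_ : I n = N @^-1` [set n%:R])//; apply/seteqP; split=> r // [].
by rewrite (_ : I n = set0)//; apply/seteqP; split=> r // [].
Qed.

Lemma expRN_integrable :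
  lebesgue_measure.-integrable `[0%R, +oo[ (fun r : R => (expR (- r))%:E).
Proof.
apply/integrable_mkcond => //.
have := @integrable_exponential_pdf R 1 ltr01.
apply: eq_integrable => // r _.
rewrite /exponential_pdf /= !patchE; case: ifPn => // _.
by rewrite mul1r mulN1r.
Qed.

Variable x0 : X.

(** Crossing a sphere of positive measure strictly increases the natural number
[xi (ball x0 r)], which therefore determines the exceptional radius. *)
Lemma Nsharp_radius_countable xi : Nsharp xi ->
  countable [set r | xi (cball x0 r) != xi (ball x0 r)].
Proof.
move=> Nxi.
have mb (r : R) : measurable (ball x0 r : set (borel X)) := Defs.measurable_ball x0 r.
have mc (r : R) : measurable (cball x0 r : set (borel X)).
  by apply: closed_borel; exact: closed_cball.
have /choice[m mE] : forall r, exists n : nat, xi (ball x0 r) = n%:R%:E.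
  by move=> r; have := Nsharp_natural Nxi (mb r) (metric_bounded_ball x0 r).
apply/countable_injP; exists m.
have H r s : xi (cball x0 r) != xi (ball x0 r) -> r < s -> m r <> m s.
  move=> /eqP ncb rs mrs; apply: ncb; apply/eqP; rewrite eq_le; apply/andP; split.
    rewrite (_ : xi (ball x0 r) = xi (ball x0 s)); last by rewrite !mE mrs.
    by rewrite le_measure ?inE//; exact: sub_cball_ball.
  by rewrite le_measure ?inE//; exact: sub_ball_cball.
move=> r s; rewrite !inE /= => Zr Zs mrs; have [rs|sr|//] := ltgtP r s.
  by have := H _ _ Zr rs.
by have := H _ _ Zs sr; rewrite mrs.
Qed.

Lemma prohorov_eq mu mu' nu nu' :
  (forall A : set (borel X), measurable A -> mu A = mu' A) ->
  (forall A : set (borel X), measurable A -> nu A = nu' A) ->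
  prohorov mu nu = prohorov mu' nu'.
Proof.
move=> mumu' nunu'; rewrite /prohorov; congr inf.
have oE A (e : R) : measurable (enlargement A e : set (borel X)).
  by apply: open_borel; exact: open_enlargement.
by apply/seteqP; split=> e [e0 H]; split => // A cA;
  have mA := closed_borel cA; have := H A cA; rewrite !mumu' ?nunu'.
Qed.

Section two_measures.
Variables (mu nu : {measure set (borel X) -> \bar R}).
Hypotheses (Nmu : Nsharp mu) (Nnu : Nsharp nu).

Local Notation D r := (prohorov (restr_ball x0 mu r) (restr_ball x0 nu r)).

(** When [r <= s], equality of the total counts [mu (ball x0 r) + nu (ball x0 r)]
and [mu (ball x0 s) + nu (ball x0 s)] forces both measures to vanish on
[ball x0 s `\` ball x0 r], so the restrictions to the two balls coincide. The
arbitrary [psi] covers the rational function in the integrand. *)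
Lemma measurable_prohorov_restr (psi : R -> R) :
  measurable_fun [set: R] (fun r => psi (D r)).
Proof.
have mb (r : R) : measurable (ball x0 r : set (borel X)) := Defs.measurable_ball x0 r.
have natb r xi : Nsharp xi -> natural_ereal (xi (ball x0 r)).
  by move=> Nxi; apply: Nsharp_natural => //; exact: metric_bounded_ball.
have finb r xi : Nsharp xi -> xi (ball x0 r) \is a fin_num.
  by move=> Nxi; apply: Nsharp_fin => //; exact: metric_bounded_ball.
have ndb xi r s : Nsharp xi -> r <= s ->
    fine (xi (ball x0 r)) <= fine (xi (ball x0 s)).
  move=> Nxi rs; rewrite -lee_fin !fineK ?finb// le_measure ?inE//.
  exact: sub_ball.
have restr_eq xi r s : Nsharp xi -> r <= s ->
    fine (xi (ball x0 r)) = fine (xi (ball x0 s)) ->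
    forall A : set (borel X), measurable A ->
    restr_ball x0 xi r A = restr_ball x0 xi s A.
  move=> Nxi rs xirs A mA; rewrite !restr_ballE.
  have xi0 : xi (ball x0 s `\` ball x0 r) = 0%E.
    apply: measure_setD_eq0 => //; [exact: sub_ball|exact: finb|].
    by rewrite -[LHS]fineK ?finb// -xirs fineK ?finb.
  have [_ mr] := measurable_restr x0 r mA; have [_ ms] := measurable_restr x0 s mA.
  apply/esym/measure_setD0 => //.
    by apply: setIS; exact: sub_ball.
  apply: subset_measure0 xi0; [exact: measurableD|exact: measurableD|].
  by move=> y [[Ay ys] Ayr]; split => // yr; apply: Ayr.
apply: (@measurable_fun_of_counter
  (fun r => fine (mu (ball x0 r)) + fine (nu (ball x0 r)))).
- by move=> r s rs; rewrite lerD ?ndb.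
- move=> r; have [n ->] := natb r mu Nmu; have [m ->] := natb r nu Nnu.
  by exists (n + m)%N; rewrite natrD.
- suff H r s : r <= s -> fine (mu (ball x0 r)) + fine (nu (ball x0 r)) =
      fine (mu (ball x0 s)) + fine (nu (ball x0 s)) -> D r = D s.
    move=> r s rsE; congr psi; have [rs|/ltW sr] := leP r s; first exact: H.
    exact/esym/H.
  move=> rs; have [mu_rs nu_rs] := (ndb _ _ _ Nmu rs, ndb _ _ _ Nnu rs).
  move=> sE; apply: prohorov_eq; apply: restr_eq => //.
    by apply/eqP; rewrite eq_le mu_rs -(lerD2r (fine (nu (ball x0 s)))) -sE lerD2l.
  by apply/eqP; rewrite eq_le nu_rs -(lerD2l (fine (mu (ball x0 s)))) -sE lerD2r.
Qed.

Lemma measurable_dsharp_integrand (A : set R) :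
  measurable_fun A (fun r => (expR (- r) * (D r / (1 + D r)))%:E).
Proof.
apply/measurable_EFinP; apply: measurable_funTS; apply: measurable_funM.
  by apply: measurableT_comp; [exact: measurable_expR|exact: oppr_measurable].
exact: (measurable_prohorov_restr (fun t => t / (1 + t))).
Qed.

Lemma dsharp_integrand_ge0 r : 0 <= expR (- r) * (D r / (1 + D r)).
Proof.
by rewrite mulr_ge0 ?expR_ge0// divr_ge0 ?addr_ge0 ?prohorov_ge0.
Qed.

Lemma dsharp_integrand_le r : expR (- r) * (D r / (1 + D r)) <= expR (- r).
Proof.
have D1 : 0 < 1 + D r by rewrite ltr_pwDl// prohorov_ge0.
by rewrite ler_piMr ?expR_ge0// ler_pdivrMr// mul1r lerDr.
Qed.

(** Otherwise the integrand would be at least the right-hand constant on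
[`[r0, r0 + 1]], since [t / (1 + t)] is increasing in [t]. *)
Lemma dsharp_lt_prohorov (r0 d : R) : 0 <= r0 -> 0 < d ->
  (dsharp x0 mu nu < (expR (- (r0 + 1)) * (d / (1 + d)))%:E)%E ->
  exists2 r, r0 <= r & D r < d.
Proof.
move=> r00 d0 Dd; apply: contrapT => nr.
have dD r : r0 <= r -> d <= D r.
  by move=> r0r; rewrite leNgt; apply/negP => Drd; apply: nr; exists r.
move: Dd; apply/negP; rewrite -leNgt.
set c := _ * _.
have sub : `[r0, r0 + 1] `<=` `[0%R, +oo[.
  by move=> r /=; rewrite !in_itv/= => /andP[r0r _]; rewrite andbT (le_trans r00).
have c0 : 0 <= c by rewrite mulr_ge0 ?expR_ge0// divr_ge0 ?addr_ge0 ?ltW.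
have <- : (\int[lebesgue_measure]_(r in `[r0, (r0 + 1)%R]) c%:E)%E = c%:E.
  rewrite integral_cst//= lebesgue_measure_itv/= lte_fin ltrDl ltr01 -EFinB.
  by rewrite addrAC subrr add0r mule1.
apply: (@le_trans _ _ (\int[lebesgue_measure]_(r in `[r0, (r0 + 1)%R])
    (expR (- r) * (D r / (1 + D r)))%:E)%E).
  apply: ge0_le_integral => //.
    exact: measurable_dsharp_integrand.
  move=> r; rewrite /= in_itv/= => /andP[r0r r1]; rewrite lee_fin.
  have D0 : 0 < 1 + D r by rewrite ltr_pwDl// prohorov_ge0.
  have d1 : 0 < 1 + d by rewrite addr_gt0.
  have dDr : d / (1 + d) <= D r / (1 + D r).
    rewrite ler_pdivrMr// mulrAC ler_pdivlMr// !mulrDr !mulr1.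
    by rewrite [d * D r]mulrC lerD2r dD.
  by apply: ler_pM => //; rewrite ?expR_ge0 ?ler_expR ?lerN2// divr_ge0 ?ltW.
apply: ge0_subset_integral => //; first exact: measurable_dsharp_integrand.
by move=> r _; rewrite lee_fin dsharp_integrand_ge0.
Qed.

End two_measures.

Section vague_dsharp.
Variables (mu_ : nat -> {measure set (borel X) -> \bar R})
  (mu : {measure set (borel X) -> \bar R}).
Hypotheses (mu_N : forall k : nat, Nsharp (mu_ k)) (muN : Nsharp mu).

Lemma vague_semicontinuous_of_dsharp :
  dsharp x0 (mu_ k) mu @[k --> \oo] --> 0%E -> vague_semicontinuous mu_ mu.
Proof.
move=> H; apply: (vague_semicontinuous_of_prohorov (x0 := x0)) => // r0 d d0.
pose r1 := Num.max r0 0.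
have r10 : 0 <= r1 by rewrite le_max lexx orbT.
pose c := expR (- (r1 + 1)) * (d / (1 + d)).
have c0 : 0 < c by rewrite mulr_gt0 ?expR_gt0// divr_gt0// addr_gt0.
have : \forall k \near \oo, (dsharp x0 (mu_ k) mu < c%:E)%E.
  apply: (H [set y | y < c%:E]%E); apply: open_nbhs_nbhs.
  by split; [exact: open_ereal_lt_ereal|rewrite /= lte_fin].
apply: filterS => k /(dsharp_lt_prohorov (mu_N k) muN r10 d0)[r r1r Drd].
by exists r => //; apply: le_trans r1r; rewrite le_max lexx.
Qed.

Lemma vague_semicontinuous_dsharp_cvg : separable X ->
  vague_semicontinuous mu_ mu -> dsharp x0 (mu_ k) mu @[k --> \oo] --> 0%E.
Proof.
move=> sepX V; rewrite /dsharp.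
pose D k r := prohorov (restr_ball x0 (mu_ k) r) (restr_ball x0 mu r).
pose Z : set R := [set r | mu (cball x0 r) != mu (ball x0 r)].
have cZ : countable Z by exact: Nsharp_radius_countable.
pose h k r := (expR (- r) * (D k r / (1 + D k r)))%:E.
have mh k : measurable_fun (`[0%R, +oo[ : set R) (h k).
  exact: measurable_dsharp_integrand.
have h0 : {ae lebesgue_measure, forall r : R, `[0%R, +oo[%classic r ->
    h k r @[k --> \oo] --> 0%E}.
  exists Z; split; [exact: countable_measurable|exact: countable_lebesgue_measure0|].
  move=> r /= /not_implyP[_]; apply: contra_notP => /negP.
  rewrite negbK => /eqP Zr.
  have D0 : D k r @[k --> \oo] --> (0 : R) by exact: prohorov_restr_cvg.
  apply: cvg_EFin; first exact: nearW.
  rewrite -(mulr0 (expR (- r))); apply: cvgM; first exact: cvg_cst.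
  rewrite -(mul0r (1 + 0)^-1); apply: cvgM => //; apply: cvgV.
    by rewrite addr0 oner_neq0.
  by apply: cvgD => //; exact: cvg_cst.
have hexp : {ae lebesgue_measure, forall (r : R) k, `[0%R, +oo[%classic r ->
    (`|h k r| <= (expR (- r))%:E)%E}.
  apply: aeW => r k _; rewrite gee0_abs ?lee_fin ?dsharp_integrand_ge0//.
  exact: dsharp_integrand_le.
have [//|_ _] := @dominated_convergence _ _ R lebesgue_measure `[0%R, +oo[
  (measurable_itv _) h (cst 0%E) (fun r => (expR (- r))%:E) mh _ h0
  expRN_integrable hexp.
by rewrite integral0.
Qed.

End vague_dsharp.
End integrated_distance.

(** * The equivalence *)

Theorem theorem1p1 (R : realType) (X : completeMetricType R)
    (sepX : separable X) (x0 : X)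
    (mu_ : nat -> {measure set (borel X) -> \bar R})
    (mu : {measure set (borel X) -> \bar R})
    (mu_N : forall k : nat, Nsharp (mu_ k)) (muN : Nsharp mu) :
  [<->
    (* (i) *)
    dsharp x0 (mu_ k) mu @[k --> \oo] --> 0%E;
    (* (ii) *)
    forall f : X -> R, continuous f -> bounded_fun f ->
      (exists2 B : set X, metric_bounded B & forall x : X, ~ B x -> f x = 0) ->
      (\int[mu_ k]_x (f x)%:E)%E @[k --> \oo] --> (\int[mu]_x (f x)%:E)%E;
    (* (iii) *)
    exists r : nat -> R,
      [/\ forall n : nat, 0 <= r n,
          increasing_seq r,
          r n @[n --> \oo] --> +oo &
          forall n : nat,
            prohorov (restr_ball x0 (mu_ k) (r n)) (restr_ball x0 mu (r n))
              @[k --> \oo] --> (0 : R)];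
    (* (iv) *)
    forall A : set (borel X), measurable A -> metric_bounded (A : set X) ->
      mu (boundary (A : set X)) = 0%E ->
      mu_ k A @[k --> \oo] --> mu A].
Proof.
tfae.
- move=> H f cf bf f0.
  apply: (vague_semicontinuous_integral_cvg _ _ _ x0) => //.
  exact: vague_semicontinuous_of_dsharp H.
- move=> H; have V := vague_semicontinuous_of_integrals mu_N muN H.
  (* One radius with null sphere in each interval [`]n, n + 1[]. *)
  have /choice[r rP] : forall n : nat, exists r : R,
      n%:R < r < n%:R + 1 /\ mu (cball x0 r) = mu (ball x0 r).
    by move=> n; have [r] := Nsharp_radius x0 n%:R muN; exists r.
  have nr n : n%:R < r n by have [/andP[]] := rP n.
  exists r; split.
  + by move=> n; apply: ltW; apply: le_lt_trans (nr n).
  + apply/increasing_seqP => n; apply: lt_trans (nr n.+1).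
    by have [/andP[_]] := rP n; rewrite natr1.
  + apply/cvgryPge => M; exists (Num.truncn M).+1 => // n /= Mn.
    apply: ltW; apply: lt_trans (nr n); apply: lt_le_trans (truncnS_gt M) _.
    by rewrite ler_nat.
  + by move=> n; apply: prohorov_restr_cvg => //; have [] := rP n.
- move=> [r [_ _ roo rcvg]] A mA bA A0.
  apply: vague_semicontinuous_cvg A0 => //.
  apply: (vague_semicontinuous_of_prohorov (x0 := x0)) => // s d d0.
  have /cvgryPge/(_ s)[n _ /(_ n (leqnn n)) sn] := roo.
  have /cvgrPdist_lt/(_ d d0) := rcvg n.
  apply: filterS => k; rewrite sub0r normrN => kd; exists (r n) => //.
  exact: le_lt_trans (ler_norm _) kd.
- move=> H; apply: vague_semicontinuous_dsharp_cvg => //.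
  exact: vague_semicontinuous_of_continuity_sets H.
Qed.
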